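(* Let $G$ be a finite group. Then $|\operatorname{Frat}(G)|$ can be determined from the knowledge of $\Lambda^*(G)$; that is, if $G$ and $H$ are finite groups with $\Lambda^*(G)=\Lambda^*(H)$, then $|\operatorname{Frat}(G)|=|\operatorname{Frat}(H)|$.
   Context: $\operatorname{Frat}(G)$ is the Frattini subgroup of $G$. For a finite group $G$ and non-negative integers $a\leq b$, $\Gamma_{a,b}(G)$ is the undirected graph, possibly with loops, whose vertices are the elements of $G^a\cup G^b$ (a disjoint union if $a\neq b$, just $G^a$ if $a=b$; $G^0$ consists of the single empty tuple), in which $(x_1,\dots,x_a)\in G^a$ and $(y_1,\dots,y_b)\in G^b$ are adjacent if and only if $\langle x_1,\dots,x_a,y_1,\dots,y_b\rangle=G$. If $a\neq b$ there are no other edges; if $a=b$ there is a loop at $x\in G^a$ exactly when the entries of $x$ generate $G$. A vertex is isolated if it is adjacent to no vertex (itself included). $\Gamma^*_{a,b}(G)$ is obtained from $\Gamma_{a,b}(G)$ by deleting the isolated vertices. $\Lambda^*(G)$ is the collection of all the connected components of the graphs $\Gamma^*_{a,b}(G)$, for all non-negative integers $a\leq b$, regarded as abstract graphs (with their loops) up to isomorphism and counted with multiplicity; the labels $a,b$ from which each graph arises are not part of the data. Thus $\Lambda^*(G)=\Lambda^*(H)$ means that there is a bijection between the two collections matching isomorphic graphs. *)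

(* Defs.v *)
From HB Require Import structures.
From mathcomp Require Import all_boot all_fingroup all_solvable.

Set Implicit Arguments.
Unset Strict Implicit.
Unset Printing Implicit Defensive.

Local Open Scope group_scope.

(* Undirected finite graphs; loops are allowed, since [adj] need not be
   irreflexive. *)
Record graph := Graph {
  vertex :> finType;
  adj : rel vertex;
  adj_sym : symmetric adj
}.

Definition induced (X : graph) (A : {set X}) : graph :=
  @Graph {x : X | x \in A} (fun u v => adj (val u) (val v))
    (fun u v => adj_sym (val u) (val v)).

(* A vertex carrying a loop is adjacent to itself, hence not isolated. *)
Definition isolated (X : graph) (x : X) : bool := [forall y, ~~ adj x y].

Definition delete_isolated (X : graph) : graph :=
  induced [set x : X | ~~ isolated x].

Definition components (X : graph) : {set {set X}} :=
  equivalence_partition (connect (@adj X)) [set: X].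

Definition graph_iso (X Y : graph) : Prop :=
  exists2 f : X -> Y, bijective f & forall x y, adj (f x) (f y) = adj x y.

Section GeneratingGraphs.

Variables (gT : finGroupType) (G : {group gT}).

(* For a <= b, the set-theoretic union of G^a and G^b, as sets of sequences
   over G of length a or b inside the finite type of sequences of length at
   most b: it is disjoint when a != b, and is just G^a when a = b. *)
Definition Gamma_vertex (a b : nat) : finType :=
  {s : b.-bseq gT | (size s \in [:: a; b]) && all [in G] s}.

Definition Gamma_adj (a b : nat) : rel (Gamma_vertex a b) := fun u v =>
  ((size (val u), size (val v)) \in [:: (a, b); (b, a)])
    && (<<[set z in val u ++ val v]>> == G).

Lemma Gamma_adj_sym (a b : nat) : symmetric (@Gamma_adj a b).
Proof.
move=> u v; rewrite /Gamma_adj.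
have -> : [set z in val u ++ val v] = [set z in val v ++ val u].
  by apply/setP=> z; rewrite !inE !mem_cat orbC.
by rewrite !inE !xpair_eqE orbC ![(size (val u) == _) && _]andbC.
Qed.

Definition Gamma (a b : nat) : graph := Graph (@Gamma_adj_sym a b).

Definition Gamma_star (a b : nat) : graph := delete_isolated (Gamma a b).

(* Lambda^*(G) is the family of graphs [Lambda_star], indexed by the
   following type. *)
Record Lambda_index := LambdaIndex {
  Lambda_a : nat;
  Lambda_b : nat;
  Lambda_le : Lambda_a <= Lambda_b;
  Lambda_comp : {set Gamma_star Lambda_a Lambda_b};
  Lambda_compP : Lambda_comp \in components (Gamma_star Lambda_a Lambda_b)
}.

Definition Lambda_star (i : Lambda_index) : graph := induced (Lambda_comp i).

End GeneratingGraphs.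

(* Equality of two families of graphs as collections of isomorphism classes
   counted with multiplicity. *)
Definition same_graphs (I J : Type) (X : I -> graph) (Y : J -> graph) : Prop :=
  exists2 f : I -> J, bijective f & forall i, graph_iso (X i) (Y (f i)).

(* Main.v *)
Require Import Defs.
From HB Require Import structures.
From mathcomp Require Import all_boot all_fingroup all_solvable.

Set Implicit Arguments.
Unset Strict Implicit.
Unset Printing Implicit Defensive.

Local Open Scope group_scope.

(** A loop in Gamma_{a,b}(G) forces a = b and produces an a-tuple that generates
    G.  Such a tuple is adjacent to every tuple, so Gamma_{a,a}(G) has no
    isolated vertex and is connected.  Hence the members of Lambda^*(G) that
    have a loop are exactly the full graphs Gamma_{a,a}(G), one for each
    a >= d(G), the minimal number of generators of G, and they have |G|^a
    vertices ([loop_model], [exists_loop]).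

    If Lambda^*(G) = Lambda^*(H), then every |G|^a with a large is a power of
    |H|.  Comparing two consecutive exponents, |G| itself is a power of |H|;
    by symmetry |G| = |H| ([same_graphs_card]).  When this common order is not 1,
    the number of vertices determines the exponent, so that Gamma_{a,a}(G) and
    Gamma_{a,a}(H) are isomorphic for the same a.

    The order of the Frattini subgroup is then read off from the classes of
    vertices with equal neighbourhoods.  Frattini elements are nongenerators, so
    multiplying the entries of a tuple by elements of Phi(G) does not change its
    neighbours: every class has at least |Phi(G)|^a members
    ([model_twins_ge]).  If a >= |G|, the class of (1, .., 1) is exactly
    Phi(G)^a, because a tuple with an entry outside a maximal subgroup M is
    distinguished from it by a tuple that enumerates M ([model_twins1]).  So
    |Phi(G)|^a is the size of the smallest class, an isomorphism invariant. *)

(** * Loops and twin classes of a graph *)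

Definition has_loop (X : graph) : bool := [exists x : X, adj x x].

Definition twins (X : graph) (x : X) : {set X} :=
  [set y | [forall z, adj x z == adj y z]].

Lemma has_loop_iso (X Y : graph) : graph_iso X Y -> has_loop X -> has_loop Y.
Proof.
by case=> f _ fE /existsP[x xx]; apply/existsP; exists (f x); rewrite fE.
Qed.

Lemma card_iso (X Y : graph) : graph_iso X Y -> #|X| = #|Y|.
Proof. by case=> f f_bij _; apply: bij_eq_card f_bij. Qed.

Lemma graph_iso_sym (X Y : graph) : graph_iso X Y -> graph_iso Y X.
Proof.
case=> f [g fK gK] fE; exists g; first by exists f.
by move=> x y; rewrite -fE !gK.
Qed.

Lemma same_graphs_sym (I J : Type) (X : I -> graph) (Y : J -> graph) :
  same_graphs X Y -> same_graphs Y X.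
Proof.
case=> f [g fK gK] fE; exists g; first by exists f.
by move=> j; apply: graph_iso_sym; rewrite -{2}(gK j); apply: fE.
Qed.

Lemma card_twins_iso (X Y : graph) (f : X -> Y) (x : X) :
  bijective f -> (forall u v, adj (f u) (f v) = adj u v) ->
  #|twins (f x)| = #|twins x|.
Proof.
move=> [g fK gK] fE; rewrite -(card_imset _ (can_inj fK)).
congr #|pred_of_set _|; apply/setP=> y; rewrite inE.
apply/forallP/imsetP=> [tw|[u]].
  exists (g y); rewrite ?gK // inE; apply/forallP=> z.
  by have := tw (f z); rewrite fE -{1}(gK y) fE.
rewrite inE => /forallP tw -> z.
by rewrite -(gK z) !fE.
Qed.

Lemma min_twins_iso (X Y : graph) (m n : nat) : graph_iso X Y ->
    (forall x : X, m <= #|twins x|) -> (exists x : X, #|twins x| = m) ->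
    (forall y : Y, n <= #|twins y|) -> (exists y : Y, #|twins y| = n) ->
  m = n.
Proof.
case=> f f_bij fE m_le [x x_min] n_le [y y_min]; have [g _ gK] := f_bij.
apply/eqP; rewrite eqn_leq -{1}y_min -{2}x_min -(gK y).
by rewrite -(card_twins_iso x f_bij fE) n_le (card_twins_iso _ f_bij fE) m_le.
Qed.

(** * Generating graphs on tuples of a fixed length *)

Section Models.

Variables (gT : finGroupType) (G : {group gT}).

Definition span {a : nat} (h k : {ffun 'I_a -> gT}) : {set gT} :=
  <<(h @: setT) :|: (k @: setT)>>.

(** The map [f] identifies [X] with Gamma_{a,a}(G).  Tuples are written as
    functions on ['I_a], which frees the rest of the argument from the nested
    subtypes used to build the members of Lambda^*(G). *)
Definition models (a : nat) (X : graph) (f : X -> {ffun 'I_a -> gT}) : Prop :=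
  [/\ injective f, codom f =i ffun_on (mem G)
    & forall x y, adj x y = (span (f x) (f y) == G)].

Lemma ffun_onS (a : nat) (h : {ffun 'I_a -> gT}) (A : {set gT}) :
  (h \in ffun_on (mem A)) = (h @: setT \subset A).
Proof.
apply/ffun_onP/subsetP=> [hA _ /imsetP[i _ ->] | hA i]; first exact: hA.
by apply: hA; apply: imset_f.
Qed.

Lemma card_model (a : nat) (X : graph) (f : X -> {ffun 'I_a -> gT}) :
  models f -> #|X| = (#|G| ^ a)%N.
Proof.
case=> f_inj f_im _.
by rewrite -(card_codom f_inj) (eq_card f_im) card_ffun_on card_ord.
Qed.

Lemma exists_enum_ffun (a : nat) (K : {group gT}) :
  #|K| <= a -> exists h : {ffun 'I_a -> gT}, h @: setT = K.
Proof.
move=> le_K_a; exists [ffun i : 'I_a => nth 1 (enum K) i].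
apply/setP=> x; apply/imsetP/idP=> [[i _ ->]|Kx].
  rewrite ffunE; case: (ltnP i (size (enum K))) => [lt_i|le_i].
    by rewrite -mem_enum mem_nth.
  by rewrite nth_default.
have lt_x: index x (enum K) < a.
  by apply: leq_trans le_K_a; rewrite cardE index_mem mem_enum.
exists (Ordinal lt_x) => //.
by rewrite ffunE nth_index ?mem_enum.
Qed.

(** The entries of [h * p] and [k] lie in the join of Phi(G) with the span of [h]
    and [k], and Phi(G) can be dropped from a generating set. *)
Lemma span_mulr_Phi (a : nat) (h p k : {ffun 'I_a -> gT}) :
  h \in ffun_on (mem G) -> k \in ffun_on (mem G) ->
  p \in ffun_on (mem 'Phi(G)) ->
  span [ffun i => h i * p i] k = G -> span h k = G.
Proof.
rewrite !ffun_onS => hG kG pP defG; apply: Phi_nongen; apply/eqP.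
rewrite eqEsubset join_subG Phi_sub subUset hG kG /= -{1}defG gen_subG subUset.
apply/andP; split; last first.
  by rewrite (subset_trans _ (joing_subr _ _)) // subsetUr.
apply/subsetP=> _ /imsetP[i _ ->]; rewrite ffunE groupM //.
  by apply/(subsetP (joing_subr _ _))/setUP; left; apply: imset_f.
by apply/(subsetP (joing_subl _ _))/(subsetP pP)/imset_f.
Qed.

Lemma span_mulr_PhiE (a : nat) (h p k : {ffun 'I_a -> gT}) :
  h \in ffun_on (mem G) -> k \in ffun_on (mem G) ->
  p \in ffun_on (mem 'Phi(G)) ->
  (span [ffun i => h i * p i] k == G) = (span h k == G).
Proof.
move=> hG kG pP; apply/eqP/eqP; first exact: span_mulr_Phi.
move=> defG; apply: (@span_mulr_Phi _ _ [ffun i => (p i)^-1]) => //.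
- apply/ffun_onP=> i; rewrite ffunE groupM ?(ffun_onP hG) //.
  by apply/(subsetP (Phi_sub G))/(ffun_onP pP).
- by apply/ffun_onP=> i; rewrite ffunE groupV (ffun_onP pP).
rewrite -{}defG; congr span.
by apply/ffunP=> i; rewrite !ffunE mulgK.
Qed.

(** Translation by Phi(G)^a embeds Phi(G)^a in the twin class of any tuple. *)
Lemma model_twins_ge (a : nat) (X : graph) (f : X -> {ffun 'I_a -> gT}) (x : X) :
  models f -> #|'Phi(G)| ^ a <= #|twins x|.
Proof.
case=> f_inj f_im f_adj; have fG y: f y \in ffun_on (mem G).
  by rewrite -f_im codom_f.
pose mulx (p : {ffun 'I_a -> gT}) := [ffun i => f x i * p i].
have mulx_inj: injective mulx.
  move=> p q /ffunP eq_pq; apply/ffunP=> i.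
  by have:= eq_pq i; rewrite !ffunE => /mulgI.
rewrite -[a in (_ ^ a)%N]card_ord -card_ffun_on -(card_imset _ mulx_inj).
rewrite -(card_imset _ f_inj); apply/subset_leq_card/subsetP=> _ /imsetP[p pP ->].
have: mulx p \in codom f.
  rewrite f_im; apply/ffun_onP=> i; rewrite ffunE groupM ?(ffun_onP (fG x)) //.
  by apply/(subsetP (Phi_sub G))/(ffun_onP pP).
case/codomP=> y def_y; rewrite def_y imset_f // inE.
apply/forallP=> z; rewrite !f_adj -def_y.
by rewrite span_mulr_PhiE.
Qed.

(** The twin class of (1, .., 1) attains the bound.  The condition on [a] lets
    every maximal subgroup be enumerated by an [a]-tuple. *)
Lemma model_twins1 (a : nat) (X : graph) (f : X -> {ffun 'I_a -> gT}) :
  models f -> #|G| <= a -> exists x : X, #|twins x| = (#|'Phi(G)| ^ a)%N.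
Proof.
move=> fM le_G_a; have [f_inj f_im f_adj] := fM.
have fG y: f y \in ffun_on (mem G) by rewrite -f_im codom_f.
have: [ffun=> 1] \in codom f.
  by rewrite f_im; apply/ffun_onP=> i; rewrite ffunE group1.
case/codomP=> x def_x; exists x; apply/eqP.
rewrite eqn_leq (@model_twins_ge _ _ _ _ fM) andbT.
rewrite -[a in (_ ^ a)%N]card_ord -card_ffun_on -(card_imset _ f_inj).
apply/subset_leq_card/subsetP=> _ /imsetP[y + ->].
rewrite inE => /forallP tw; apply/ffun_onP=> i.
apply: contraT => yi_Phi.
have [M maxM yi_M]: exists2 M : {group gT}, maximal M G & f y i \notin M.
  apply/exists_inP; apply: contraR yi_Phi; rewrite negb_exists_in.
  move/forall_inP=> in_max; apply/bigcapP=> M /predU1P[-> | maxM].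
    exact: (ffun_onP (fG y)).
  by rewrite -[_ \in _]negbK in_max.
have sMG := proper_sub (maxgroupp maxM).
(* The tuple k enumerating M separates f y from (1, .., 1): together with f y
   it generates G by maximality of M, together with 1 it only generates M. *)
have [k im_k] := @exists_enum_ffun a M (leq_trans (subset_leq_card sMG) le_G_a).
have: k \in codom f by rewrite f_im ffun_onS im_k.
case/codomP=> z def_k; have:= tw z.
rewrite !f_adj -def_x -def_k /span im_k.
have -> : <<([ffun=> 1] : {ffun 'I_a -> gT}) @: setT :|: M>> = M.
  apply/eqP; rewrite eqEsubset gen_subG subUset subxx andbT sub_gen ?subsetUr //.
  by rewrite andbT -ffun_onS; apply/ffun_onP=> j; rewrite ffunE group1.
rewrite (negPf (proper_neq (maxgroupp maxM))) => /eqP/esym/negbT/negP[].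
rewrite eqEsubset gen_subG subUset -ffun_onS fG sMG /=.
(* If f y and k did not generate G, their span would be a proper subgroup
   containing M, hence M itself, although it contains f y i. *)
have [_ maxM'] := maxgroupP maxM.
apply: contraR yi_M => not_sub.
rewrite -(maxM' <<f y @: setT :|: M>>%G).
- by apply/mem_gen/setUP; left; apply: imset_f.
- by rewrite properE not_sub gen_subG subUset -ffun_onS fG sMG.
- by rewrite sub_gen ?subsetUr.
Qed.

(** The vertex with a loop is a generating tuple [u], adjacent to all tuples, so
    nothing is deleted as isolated and the component of [u] is everything. *)
Lemma loop_model (i : Lambda_index G) : has_loop (Lambda_star i) ->
  exists f : Lambda_star i -> {ffun 'I_(Lambda_a i) -> gT}, models f.
Proof.
case: i => a b le_ab C CP; rewrite /Lambda_star /=.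
case/existsP=> -[[u u_ni] uC]; rewrite /= => /[dup] uu /andP[].
rewrite !inE !xpair_eqE => /orP sz_u gen_u.
have eq_ab: a = b.
  by case: sz_u => /andP[/eqP sz1 /eqP sz2]; [rewrite -[a]sz1 | rewrite -[a]sz2].
subst b; clear sz_u.
have sz (v : Gamma_vertex G a a) : size (val v) = a.
  by case/andP: (valP v); rewrite !inE orbb => /eqP.
have vG (v : Gamma_vertex G a a) : all [in G] (val v).
  by case/andP: (valP v).
have adj_u (v : Gamma_vertex G a a) : @Gamma_adj gT G a a u v.
  rewrite /Gamma_adj !sz inE eqxx /= eqEsubset gen_subG; apply/andP; split.
    apply/subsetP=> z; rewrite inE mem_cat => /orP[] z_in.
      exact: (allP (vG u)).
    exact: (allP (vG v)).
  rewrite -{1}(eqP gen_u) genS //; apply/subsetP=> z.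
  by rewrite !inE !mem_cat orbb => ->.
have ni (v : Gamma G a a) : v \in [set x : Gamma G a a | ~~ isolated x].
  rewrite inE; apply/forallPn; exists u.
  by rewrite negbK adj_sym; apply: adj_u.
pose star v : Gamma_star G a a := exist _ v (ni v).
have inC v : star v \in C.
  case/imsetP: CP uC => w _ ->; rewrite !inE => w_u.
  apply: connect_trans w_u _; apply: connect1; exact: adj_u.
pose f (x : induced C) : {ffun 'I_a -> gT} :=
  [ffun i : 'I_a => nth 1 (val (val (val (val x)))) i].
have im_f x : f x @: setT = [set z in val (val (val (val x)))].
  apply/setP=> z; rewrite inE; apply/imsetP/idP=> [[i _ ->]|].
    by rewrite ffunE mem_nth // sz.
  case/(nthP 1)=> i; rewrite sz => lt_i <-.
  by exists (Ordinal lt_i); rewrite ?ffunE.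
exists f; split.
- move=> x y /ffunP eq_xy; do 4!apply: val_inj.
  apply: (@eq_from_nth _ 1); rewrite !sz // => i lt_i.
  by have:= eq_xy (Ordinal lt_i); rewrite !ffunE.
- move=> h; apply/codomP/idP=> [[x ->]|hG].
    rewrite ffun_onS im_f; apply/subsetP=> z; rewrite inE.
    exact: (allP (vG _)).
  have sz_s : size (codom h) <= a by rewrite size_codom card_ord.
  have sP : (size (Bseq sz_s) \in [:: a; a]) && all [in G] (Bseq sz_s).
    rewrite /= size_codom card_ord inE eqxx; apply/allP=> _ /codomP[i ->].
    exact: (ffun_onP hG).
  pose v : Gamma G a a := exist _ (Bseq sz_s) sP.
  exists (exist _ (star v) (inC v)); apply/ffunP=> i; rewrite ffunE /=.
  by rewrite (nth_map i) ?nth_ord_enum // size_enum_ord.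
- move=> x y; rewrite /span !im_f /adj /= /Gamma_adj !sz inE eqxx /=.
  congr (_ == _); congr <<_>>; apply/setP=> z.
  by rewrite !inE mem_cat.
Qed.

(** The component of a tuple that lists all the elements of G. *)
Lemma exists_loop (a : nat) : #|G| <= a ->
  exists2 i : Lambda_index G, Lambda_a i = a & has_loop (Lambda_star i).
Proof.
case/exists_enum_ffun=> h im_h.
have sz_s : size (codom h) <= a by rewrite size_codom card_ord.
have sP : (size (Bseq sz_s) \in [:: a; a]) && all [in G] (Bseq sz_s).
  rewrite /= size_codom card_ord inE eqxx; apply/allP=> _ /codomP[i ->].
  by rewrite -im_h imset_f.
pose u : Gamma G a a := exist _ (Bseq sz_s) sP.
have uu : adj u u.
  rewrite /= /Gamma_adj /= size_codom card_ord inE eqxx /=.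
  apply/eqP; rewrite -[RHS]genGid -{1}im_h; congr <<_>>.
  apply/setP=> z; rewrite inE mem_cat orbb.
  by apply/codomP/imsetP=> [[i ->]|[i _ ->]]; exists i.
have u_ni : u \in [set x : Gamma G a a | ~~ isolated x].
  by rewrite inE; apply/forallPn; exists u; rewrite negbK.
pose su : Gamma_star G a a := exist _ u u_ni.
pose C := [set y in [set: Gamma_star G a a] | connect (@adj _) su y].
have CP : C \in components (Gamma_star G a a) by apply: imset_f.
have uC : su \in C by rewrite !inE connect0.
exists (@LambdaIndex gT G a a (leqnn a) C CP) => //.
by apply/existsP; exists (exist _ su uC).
Qed.

End Models.

(** * Recovering the order of the group, then of its Frattini subgroup *)

Lemma same_graphs_expn (gT rT : finGroupType) (G : {group gT}) (H : {group rT})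
    (a : nat) :
  same_graphs (@Lambda_star gT G) (@Lambda_star rT H) -> #|G| <= a ->
  exists p, (#|G| ^ a = #|H| ^ p)%N.
Proof.
case=> F _ isoF /exists_loop[i <- loop_i].
have [f /card_model <-] := loop_model loop_i.
have [g /card_model g_card] := loop_model (has_loop_iso (isoF i) loop_i).
by exists (Lambda_a (F i)); rewrite (card_iso (isoF i)).
Qed.

(** If |G|^n = |H|^p and |G|^(n+1) = |H|^q, then |G| = |H|^(q - p). *)
Lemma same_graphs_card_pow (gT rT : finGroupType)
    (G : {group gT}) (H : {group rT}) :
  same_graphs (@Lambda_star gT G) (@Lambda_star rT H) ->
  exists k, (#|G| = #|H| ^ k)%N.
Proof.
move=> sGH; have [p def_p] := same_graphs_expn sGH (leqnn _).
have [q] := same_graphs_expn sGH (leqnSn _).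
rewrite expnS def_p => def_q.
have H_gt0 : 0 < #|H| := cardG_gt0 H.
(* The case q < p is only possible when |H| = 1. *)
case: (leqP p q) => [le_pq | lt_qp].
  exists (q - p)%N; apply/eqP; rewrite -(@eqn_pmul2r (#|H| ^ p)) ?expn_gt0 ?H_gt0 //.
  by rewrite -expnD subnK // def_q.
have := H_gt0; rewrite leq_eqVlt => /predU1P[H1 | H_gt1].
  by exists 0; move: def_q; rewrite -H1 !exp1n muln1.
by have := lt_qp; rewrite -(ltn_exp2l _ _ H_gt1) -def_q ltnNge leq_pmull.
Qed.

Lemma same_graphs_card (gT rT : finGroupType)
    (G : {group gT}) (H : {group rT}) :
  same_graphs (@Lambda_star gT G) (@Lambda_star rT H) -> #|G| = #|H|.
Proof.
move=> sGH; have [k def_G] := same_graphs_card_pow sGH.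
have [l def_H] := same_graphs_card_pow (same_graphs_sym sGH).
(* Each order is a power of the other, so each bounds the other from above,
   unless one of them is 1. *)
have base_le_pow m n j : 0 < m -> n = (m ^ j)%N -> m = 1%N \/ n = 1%N \/ m <= n.
  move=> m_gt0 ->; case: j => [|j]; first by right; left.
  by right; right; rewrite expnS leq_pmulr // expn_gt0 m_gt0.
have [H1|[G1|le_HG]] := base_le_pow _ _ _ (cardG_gt0 H) def_G.
- by rewrite def_G H1 exp1n.
- by rewrite def_H G1 exp1n.
have [G1|[H1|le_GH]] := base_le_pow _ _ _ (cardG_gt0 G) def_H.
- by rewrite def_H G1 exp1n.
- by rewrite def_G H1 exp1n.
by apply/eqP; rewrite eqn_leq le_HG le_GH.
Qed.

Theorem proposition5p17 (gT rT : finGroupType) (G : {group gT}) (H : {group rT}) :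
  same_graphs (@Lambda_star gT G) (@Lambda_star rT H) ->
  #|'Phi(G)| = #|'Phi(H)|.
Proof.
move=> sGH; have eq_card_GH := same_graphs_card sGH.
have [G_le1 | G_gt1] := leqP #|G| 1.
  have Phi1 (sT : finGroupType) (K : {group sT}) : #|K| <= 1 -> #|'Phi(K)| = 1%N.
    move=> K1; apply/eqP; rewrite eqn_leq cardG_gt0 andbT.
    exact: leq_trans (subset_leq_card (Phi_sub K)) K1.
  by rewrite !Phi1 // -eq_card_GH.
case: sGH => F _ isoF.
have [i def_a loop_i] := exists_loop (leqnn #|G|).
have [f fM] := loop_model loop_i.
have [g gM] := loop_model (has_loop_iso (isoF i) loop_i).
have def_b : Lambda_a (F i) = #|G|.
  apply/eqP; rewrite -(eqn_exp2l _ _ G_gt1) {1}eq_card_GH -(card_model gM).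
  by rewrite -(card_iso (isoF i)) (card_model fM) def_a.
have le_a : #|G| <= Lambda_a i by rewrite def_a.
have le_b : #|H| <= Lambda_a (F i) by rewrite def_b eq_card_GH.
have eq_min := min_twins_iso (isoF i)
  (fun x => model_twins_ge x fM) (model_twins1 fM le_a)
  (fun y => model_twins_ge y gM) (model_twins1 gM le_b).
by apply/eqP; rewrite -(@eqn_exp2r _ _ #|G|) // -{1}def_a eq_min def_b.
Qed.
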